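(* Let $B$ be a finite set in a group and let $\alpha,\beta>0$. Suppose that $|BB|\leq\alpha|B|$ and $|BbB|\leq\beta|B|$ for all $b\in B$. Then for every integer $h>2$, $$|B^h|\leq \alpha^{8h-17}\beta^{h-2}|B|.$$
   Context: For subsets $U,V$ of a group, $UV=\{uv:u\in U,v\in V\}$; $BbB=\{b_1bb_2: b_1,b_2\in B\}$; $B^h$ denotes the $h$-fold product set $B\cdots B$ ($h$ factors). *)

(* Defs.v *)
From mathcomp Require Export all_boot all_order all_algebra.
From mathcomp Require Export finmap reals.

Set Implicit Arguments.
Unset Strict Implicit.
Unset Printing Implicit Defensive.

Local Open Scope group_scope.
Local Open Scope fset_scope.

Definition prodset (G : groupType) (U V : {fset G}) : {fset G} :=
  [fset u * v | u in U, v in V].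

Definition sandwich (G : groupType) (B : {fset G}) (b : G) : {fset G} :=
  [fset b1 * b * b2 | b1 in B, b2 in B].

(* For h > 0 the trailing factor {1} does not change the h-fold product. *)
Definition powset (G : groupType) (B : {fset G}) (h : nat) : {fset G} :=
  iter h (prodset B) [fset 1].

(* Main.v *)
(** Following Petridis, choose a nonempty [Y] in [B] minimising [|BY|/|Y|]; then
    [|BYC| <= alpha |YC|] for every finite [C].  Ruzsa's covering argument gives
    a subset [T] of [B] with [|T| <= alpha] and [B] contained in [T Y Y^-1], so
    [|BBC|] is at most the sum over [t] in [T] of [|B t Y Y^-1 C|].  Ruzsa's
    triangle inequality with pivots [B] and [B^-1] bounds each summand by
    [beta alpha^5 |BC|].  Hence [|BBC| <= alpha^6 beta |BC|], and the theorem
    follows by induction from [|BB| <= alpha |B|], since [alpha >= 1] when [B]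
    is nonempty. *)
Require Import Defs.
From mathcomp Require Import zify ring.

Set Implicit Arguments.
Unset Strict Implicit.
Unset Printing Implicit Defensive.

Import Order.TTheory GRing.Theory Num.Theory.

Local Open Scope fset_scope.
Local Open Scope nat_scope.

Local Infix "**" := prodset (at level 40, left associativity).

(** * Algebra and cardinalities of product and inverse sets *)

Definition invset (G : groupType) (U : {fset G}) : {fset G} :=
  [fset (u^-1)%g | u in U].

Lemma cardfsM (K K' : choiceType) (A : {fset K}) (B : {fset K'}) :
  #|` A `*` B| = #|` A| * #|` B|.
Proof.
rewrite -(size_allpairs (fun x y => (x, y)) A B); apply/perm_size/uniq_perm => //.
  by apply: allpairs_uniq => // -[? ?] [? ?].
move=> [x y]; rewrite in_fsetM /=; apply/andP/allpairsP => [[xA yB]|[p [pA pB [-> ->]]]] //.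
by exists (x, y).
Qed.

Section ProductSets.
Variable G : groupType.
Implicit Types (A B C T U V W Y Z : {fset G}) (a b x y : G).

Lemma prodsetP U V x :
  reflect (exists u v, [/\ u \in U, v \in V & x = (u * v)%g]) (x \in U ** V).
Proof.
apply: (iffP (imfset2P _ _ _ _ _)) => [[u /= uU [v /= vV ->]]|[u [v [uU vV ->]]]].
  by exists u, v.
by exists u => //; exists v.
Qed.

Lemma mem_prodset U V u v : u \in U -> v \in V -> (u * v)%g \in U ** V.
Proof. by move=> uU vV; apply/prodsetP; exists u, v. Qed.

Lemma prodsetA U V W : U ** (V ** W) = U ** V ** W.
Proof.
apply/fsetP => x; apply/prodsetP/prodsetP.
  case=> [u [_ [uU /prodsetP[v [w [vV wW ->]]] ->]]]; exists (u * v)%g, w.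
  by rewrite mulgA; split=> //; apply: mem_prodset.
case=> [_ [w [/prodsetP[u [v [uU vV ->]]] wW ->]]]; exists u, (v * w)%g.
by rewrite mulgA; split=> //; apply: mem_prodset.
Qed.

Lemma prodsetSS U U' V V' : U `<=` U' -> V `<=` V' -> U ** V `<=` U' ** V'.
Proof.
move=> /fsubsetP sU /fsubsetP sV; apply/fsubsetP => _ /prodsetP[u [v [uU vV ->]]].
by apply: mem_prodset; [apply: sU | apply: sV].
Qed.

Lemma prodset0 U : U ** fset0 = fset0.
Proof. by apply/fsetP => x; rewrite inE; apply/prodsetP => -[? [? []]]. Qed.

Lemma prod0set U : fset0 ** U = fset0.
Proof. by apply/fsetP => x; rewrite inE; apply/prodsetP => -[? [? []]]. Qed.

Lemma prodset1 U : U ** [fset 1%g] = U.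
Proof.
apply/fsetP => x; apply/prodsetP/idP => [[u [v [uU]]]|xU].
  by rewrite inE => /eqP-> ->; rewrite mulg1.
by exists x, 1%g; rewrite inE mulg1.
Qed.

Lemma prodsetUr U V W : U ** (V `|` W) = U ** V `|` U ** W.
Proof.
apply/fsetP => x; rewrite inE; apply/prodsetP/orP.
  by move=> [u [v [uU]]]; rewrite inE => /orP[vV|vW] ->; [left|right]; apply: mem_prodset.
by case=> /prodsetP[u [v [uU vV ->]]]; exists u, v; rewrite inE vV ?orbT.
Qed.

Lemma prodsetUl U V W : (U `|` V) ** W = U ** W `|` V ** W.
Proof.
apply/fsetP => x; rewrite inE; apply/prodsetP/orP.
  by move=> [u [v []]]; rewrite inE => /orP[uU|uV] vW ->; [left|right]; apply: mem_prodset.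
by case=> /prodsetP[u [v [uU vV ->]]]; exists u, v; rewrite inE uU ?orbT.
Qed.

Lemma card_prodset1r U a : #|` U ** [fset a]| = #|` U|.
Proof.
have -> : U ** [fset a] = [fset (u * a)%g | u in U].
  apply/fsetP => x; apply/prodsetP/imfsetP => /= [[u [v [uU]]]|[u uU ->]].
    by rewrite inE => /eqP-> ->; exists u.
  by exists u, a; rewrite inE.
by rewrite card_imfset //=; apply: mulIg.
Qed.

Lemma card_prodset1l U a : #|` [fset a] ** U| = #|` U|.
Proof.
have -> : [fset a] ** U = [fset (a * u)%g | u in U].
  apply/fsetP => x; apply/prodsetP/imfsetP => /= [[v [u []]]|[u uU ->]].
    by rewrite inE => /eqP-> uU ->; exists u.
  by exists a, u; rewrite inE.
by rewrite card_imfset //=; apply: mulgI.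
Qed.

Lemma mem_invset U x : (x \in invset U) = ((x^-1)%g \in U).
Proof.
apply/imfsetP/idP => /= [[u uU ->]|xU]; first by rewrite invgK.
by exists (x^-1)%g; rewrite ?invgK.
Qed.

Lemma invsetK : involutive (@invset G).
Proof. by move=> U; apply/fsetP => x; rewrite !mem_invset invgK. Qed.

Lemma card_invset U : #|` invset U| = #|` U|.
Proof. by rewrite card_imfset //=; apply: invg_inj. Qed.

Lemma invsetM U V : invset (U ** V) = invset V ** invset U.
Proof.
apply/fsetP => x; rewrite mem_invset; apply/prodsetP/prodsetP.
  move=> [u [v [uU vV xE]]]; exists (v^-1)%g, (u^-1)%g.
  by rewrite !mem_invset !invgK -invgM -xE invgK.
move=> [u [v []]]; rewrite !mem_invset => uV vU ->.
by exists (v^-1)%g, (u^-1)%g; rewrite invgM.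
Qed.

(** * Ruzsa's triangle inequality and covering lemma *)

Lemma ruzsa_triangle U V W :
  #|` W| * #|` U ** V| <= #|` U ** W| * #|` invset W ** V|.
Proof.
(* [r x] selects a left factor of [x]; the default [1] is never reached for [x] in [U ** V]. In
   [g (w, x)] the product of the coordinates is [x], which determines [r x], and then the first
   coordinate gives [w]. *)
pose r x := nth 1%g [seq u <- U | (u^-1 * x)%g \in V] 0.
pose g (p : G * G) := ((r p.2 * p.1)%g, (p.1^-1 * ((r p.2)^-1 * p.2))%g).
have gE p : ((g p).1 * (g p).2)%g = p.2 by rewrite /= mulgA mulgK mulVKg.
have rP x : x \in U ** V -> r x \in U /\ ((r x)^-1 * x)%g \in V.
  move=> /prodsetP[u [v [uU vV xE]]]; rewrite /r.
  have : u \in [seq u <- U | (u^-1 * x)%g \in V] by rewrite mem_filter xE mulKg vV.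
  case E: [seq _ <- _ | _] => [//|w s] _ /=.
  have : w \in [seq u <- U | (u^-1 * x)%g \in V] by rewrite E mem_head.
  by rewrite mem_filter => /andP[].
have g_inj : injective g.
  move=> [w x] [w' x'] gg; have xx : x' = x by have := gE (w, x); rewrite gg gE.
  by move: gg; rewrite xx => -[/mulgI->].
rewrite -!cardfsM.
have -> : #|` W `*` (U ** V)| = #|` [fset g p | p in W `*` (U ** V)]|.
  by rewrite card_imfset.
apply: fsubset_leq_card; apply/fsubsetP => _ /imfsetP[[w x] /= + ->].
rewrite !in_fsetM /= => /andP[wW /rP[uU vV]].
by rewrite !mem_prodset // mem_invset invgK.
Qed.

(** Elements of [A] are added to [T] greedily while the translates [t Y] stay disjoint, which the
    equality for [T ** Y] records. If [a Y] meets some [t Y], then [a] lies in [t Y Y^-1] and is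
    already covered. *)
Lemma ruzsa_covering A Y : Y != fset0 -> exists T,
  [/\ T `<=` A, A `<=` T ** (Y ** invset Y) & #|` T| * #|` Y| <= #|` A ** Y|].
Proof.
move=> /fset0Pn[y yY].
suff [T [TA AT TY]] : exists T,
    [/\ T `<=` A, A `<=` T ** (Y ** invset Y) & #|` T ** Y| = #|` T| * #|` Y|].
  by exists T; split=> //; rewrite -TY; apply/fsubset_leq_card/prodsetSS.
elim/fset1U_rect: A => [|a A aA [T [TA AT TY]]].
  by exists fset0; rewrite !fsub0set prod0set cardfs0.
have [aT|aT] := boolP (a \in T ** (Y ** invset Y)).
  by exists T; rewrite fsubUset fsub1set aT AT (fsubset_trans TA) ?fsubsetUr.
have aNT : a \notin T by apply: contra aA; apply: (fsubsetP TA).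
exists (a |` T); split; first exact: fsetUS.
  rewrite prodsetUl fsetUSS // fsub1set; apply/prodsetP.
  exists a, (y * y^-1)%g; rewrite inE eqxx mem_prodset ?mem_invset ?invgK //.
  by rewrite mulgV mulg1.
rewrite prodsetUl cardfsU disjoint_fsetI0 ?cardfs0 ?subn0.
  by rewrite card_prodset1l TY cardfsU1 aNT mulnDl mul1n.
apply/fdisjointP => _ /prodsetP[_ [u [/fset1P-> uY ->]]].
apply: contra aT => /prodsetP[t [v [tT vY /(canRL (mulgK _))->]]].
by rewrite -mulgA !mem_prodset // mem_invset invgK.
Qed.

(** * Petridis's lemma on sets of minimal growth *)

Definition growth_minimal B Y :=
  forall Z, Z `<=` Y -> #|` B ** Y| * #|` Z| <= #|` B ** Z| * #|` Y|.

(** Strong induction on [C], with ratios compared by cross multiplication: either [C] is minimal, or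
    some [Z] in [C] has a strictly smaller ratio. Strictness makes [Z] nonempty and proper, and a
    minimal subset of [Z] then serves for [C]. *)
Lemma growth_minimal_exists B C : C != fset0 -> exists Y,
  [/\ Y `<=` C, Y != fset0, growth_minimal B Y
    & #|` B ** Y| * #|` C| <= #|` B ** C| * #|` Y|].
Proof.
elim/finSet_rect: C => C IHC C0.
have [/allP minC|/allPn[Z]] := boolP (all (fun Z : {fset G} =>
    #|` B ** C| * #|` Z| <= #|` B ** Z| * #|` C|) (fpowerset C)).
  by exists C; split=> // Z ZC; apply: minC; rewrite fpowersetE.
rewrite fpowersetE -ltnNge => ZC ltZC.
have Z0 : Z != fset0 by apply: contraTneq ltZC => ->; rewrite cardfs0 muln0.
have ZpC : Z `<` C.
  by rewrite fproperEneq ZC andbT; apply: contraTneq ltZC => ->; rewrite ltnn.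
have [Y [YZ Y0 minY leYZ]] := IHC Z ZpC Z0.
exists Y; split=> //; first exact: fsubset_trans ZC.
move: ltZC leYZ Z0; rewrite -cardfs_gt0; nia.
Qed.

(** Elements [c] join [C] one at a time. With [Z] the set of [y] such that [y c] is already in
    [Y ** C], the set [Y ** C] gains exactly [|Y| - |Z|] elements, while [B ** Y ** C] gains at most
    [|BY| - |BZ|], since it already contains [B Z c]. *)
Lemma petridis B Y C : growth_minimal B Y ->
  #|` B ** Y ** C| * #|` Y| <= #|` B ** Y| * #|` Y ** C|.
Proof.
move=> minY; elim/fset1U_rect: C => [|c C _ IHC]; first by rewrite !prodset0 cardfs0.
pose Z := [fset y in Y | (y * c)%g \in Y ** C].
have ZY : Z `<=` Y by apply/fsubsetP => y; rewrite !inE => /andP[].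
have cardYC : #|` Y ** (c |` C)| = #|` Y ** C| + (#|` Y| - #|` Z|).
  have -> : Y ** (c |` C) = Y ** C `|` (Y `\` Z) ** [fset c].
    apply/fsetP => x; rewrite prodsetUr !inE orbC; have [//|xC] := boolP (x \in Y ** C).
    apply/prodsetP/prodsetP => -[y [_ [yY /fset1P-> xE]]]; exists y, c; split; rewrite ?inE //.
      by rewrite yY andbT /= -xE.
    by move: yY; rewrite !inE => /andP[].
  rewrite cardfsU disjoint_fsetI0 ?cardfs0 ?subn0.
    by rewrite card_prodset1r cardfsDS.
  rewrite fdisjoint_sym; apply/fdisjointP => _ /prodsetP[y [_ [yYZ /fset1P-> ->]]].
  by move: yYZ; rewrite !inE => /andP[/nandP[/negPf->|]].
have cardBYC : #|` B ** Y ** (c |` C)| <=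
    #|` B ** Y ** C| + (#|` B ** Y| - #|` B ** Z|).
  rewrite -cardfsDS ?prodsetSS // -(card_prodset1r (_ `\` _) c).
  rewrite -cardfsUI; apply: leq_trans (leq_addr _ _).
  apply/fsubset_leq_card/fsubsetP => x; rewrite prodsetUr [in X in X -> _]inE orbC inE.
  have [//|xC /= /prodsetP[w [_ [wBY /fset1P-> xE]]]] := boolP (x \in B ** Y ** C).
  rewrite xE mem_prodset ?inE // wBY andbT.
  apply: contra xC => /prodsetP[b [z [bB]]]; rewrite !inE => /andP[_ zcYC] wE.
  by rewrite xE wE -mulgA -prodsetA mem_prodset.
(* Minimality at [Z] compares the two gains; the next two bounds make the truncated subtractions
   exact. *)
have := minY Z ZY.
have := fsubset_leq_card ZY.
have : #|` B ** Z| <= #|` B ** Y| by apply/fsubset_leq_card/prodsetSS.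
rewrite cardYC; nia.
Qed.

End ProductSets.

(** * Ratio forms over an ordered field *)

Local Open Scope ring_scope.

Section SmallDoubling.
Variables (R : realFieldType) (G : groupType).
Implicit Types (B C D T U V W Y : {fset G}) (x : R).

(** An exchange rule: the left factor [U] is replaced by the inverse of the pivot [W], at the cost
    of a bound on [|UW| / |W|]. *)
Lemma ruzsa_triangle_ratio x U V W : W != fset0 ->
  #|` U ** W|%:R <= x * #|` W|%:R -> #|` U ** V|%:R <= x * #|` invset W ** V|%:R.
Proof.
rewrite -cardfs_gt0 -(ltr0n R) => W0 UW; rewrite -(ler_pM2l W0) -natrM.
apply: le_trans (_ : (#|` U ** W| * #|` invset W ** V|)%:R <= _).
  by rewrite ler_nat ruzsa_triangle.
by rewrite natrM mulrA [_ * x]mulrC ler_wpM2r.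
Qed.

Lemma card_prodset_middle x U T V :
    (forall t, t \in T -> #|` U ** [fset t] ** V|%:R <= x) ->
  #|` U ** T ** V|%:R <= #|` T|%:R * x.
Proof.
elim/fset1U_rect: T => [|t T tT IHT] UtV.
  by rewrite prodset0 prod0set cardfs0 mul0r.
rewrite cardfsU1 tT natrD mulrDl mul1r prodsetUr prodsetUl.
apply: le_trans (_ : (#|` U ** [fset t] ** V| + #|` U ** T ** V|)%:R <= _).
  by rewrite ler_nat cardfsU leq_subr.
rewrite natrD lerD ?UtV ?fset1U1 ?IHT // => s sT.
by rewrite UtV // fset1Ur.
Qed.

Lemma sandwichE B b : sandwich B b = B ** [fset b] ** B.
Proof.
apply/fsetP => x; apply/imfset2P/prodsetP => /=.
  case=> b1 b1B [b2 b2B ->]; exists (b1 * b)%g, b2; split=> //.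
  by rewrite mem_prodset // inE.
case=> [_ [b2 [/prodsetP[b1 [c [b1B /fset1P-> ->]]] b2B ->]]].
by exists b1 => //; exists b2.
Qed.

Lemma doubling_ge1 alpha B : B != fset0 ->
  #|` B ** B|%:R <= alpha * #|` B|%:R -> 1 <= alpha :> R.
Proof.
move=> B0; have [b bB] := fset0Pn _ B0; move: B0.
rewrite -cardfs_gt0 -(ltr0n R) => B0 BB; rewrite -(ler_pM2r B0) mul1r.
apply: le_trans BB; rewrite ler_nat -(card_prodset1l B b).
by rewrite fsubset_leq_card // prodsetSS // fsub1set.
Qed.

(** * The cost of one more factor [B], and the induction *)

Lemma card_prodset_step (alpha beta : R) B C :
    0 < alpha -> 0 < beta -> #|` B ** B|%:R <= alpha * #|` B|%:R ->
    (forall b, b \in B -> #|` sandwich B b|%:R <= beta * #|` B|%:R) ->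
  #|` B ** (B ** C)|%:R <= alpha ^+ 6 * beta * #|` B ** C|%:R.
Proof.
move=> alpha0 beta0 BB BbB; have [->|B0] := eqVneq B fset0.
  by rewrite !prod0set cardfs0 mulr0.
have [Y [YB Y0 minY leYB]] := growth_minimal_exists B B0.
have B'0 : invset B != fset0 by rewrite -cardfs_gt0 card_invset cardfs_gt0.
have cB : 0 < #|` B|%:R :> R by rewrite ltr0n cardfs_gt0.
have cY : 0 < #|` Y|%:R :> R by rewrite ltr0n cardfs_gt0.
have BY : #|` B ** Y|%:R <= alpha * #|` Y|%:R.
  rewrite -(ler_pM2r cB) -natrM mulrAC.
  apply: le_trans (_ : (#|` B ** B| * #|` Y|)%:R <= _); first by rewrite ler_nat.
  by rewrite natrM ler_wpM2r.
have BYD D : #|` B ** Y ** D|%:R <= alpha * #|` Y ** D|%:R.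
  rewrite -(ler_pM2r cY) -natrM.
  apply: le_trans (_ : (#|` B ** Y| * #|` Y ** D|)%:R <= _).
    by rewrite ler_nat petridis.
  by rewrite natrM mulrAC ler_wpM2r.
have BVBV : #|` invset B ** invset B|%:R <= alpha * #|` invset B|%:R.
  by rewrite -invsetM !card_invset.
(* Pivot [B] costs [alpha] and leaves [B^-1 B^-1], which costs another. *)
have BBV : #|` B ** invset B|%:R <= alpha ^+ 2 * #|` B|%:R.
  apply: le_trans (ruzsa_triangle_ratio _ B0 BB) _.
  by rewrite expr2 -mulrA ler_pM2l // -(card_invset B).
(* Pivot [B^-1]: the set [Y Y^-1 B^-1] is the inverse of [B Y Y^-1], so its size is at most
   [alpha |Y Y^-1|], hence at most [alpha |B B^-1|]. *)
have YYVC : #|` Y ** invset Y ** C|%:R <= alpha ^+ 3 * #|` B ** C|%:R.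
  rewrite -(invsetK B); apply: ruzsa_triangle_ratio B'0 _.
  rewrite card_invset -(card_invset (_ ** _)) !invsetM !invsetK prodsetA.
  apply: le_trans (BYD _) _; rewrite exprS -mulrA ler_pM2l //.
  apply: le_trans BBV; rewrite ler_nat fsubset_leq_card // prodsetSS //.
  by apply/fsubsetP => y; rewrite !mem_invset => /(fsubsetP YB).
(* Pivot [B^-1] turns the left [B^-1] into [B] for one [alpha]; minimality of [Y] removes that [B]
   for another. *)
have BVYYVC : #|` invset B ** (Y ** invset Y ** C)|%:R <= alpha ^+ 5 * #|` B ** C|%:R.
  apply: le_trans (ruzsa_triangle_ratio _ B'0 BVBV) _; rewrite invsetK.
  rewrite exprS -mulrA ler_pM2l // -!prodsetA prodsetA.
  apply: le_trans (BYD _) _; rewrite exprS -mulrA ler_pM2l //.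
  by rewrite prodsetA.
have [T [TB BT cT]] := ruzsa_covering B Y0.
have leT : #|` T|%:R <= alpha.
  rewrite -(ler_pM2r cY) -natrM; apply: le_trans BY; by rewrite ler_nat.
(* Pivot [B]: as [t] lies in [B], the cost [|B t B| / |B|] is at most [beta]. *)
have BtD t : t \in T -> #|` B ** [fset t] ** (Y ** invset Y ** C)|%:R <=
    beta * (alpha ^+ 5 * #|` B ** C|%:R).
  move=> /(fsubsetP TB) tB.
  apply: le_trans (ruzsa_triangle_ratio _ B0 (_ : _ <= beta * _)) _.
    by rewrite -sandwichE BbB.
  by rewrite ler_pM2l.
(* The second factor [B] is covered by [T Y Y^-1]; summing over at most [alpha] elements of [T]
   gives the sixth power. *)
apply: le_trans (_ : #|` B ** T ** (Y ** invset Y ** C)|%:R <= _).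
  by rewrite ler_nat fsubset_leq_card // -prodsetA prodsetSS // prodsetA prodsetSS.
apply: le_trans (card_prodset_middle BtD) _.
have -> : alpha ^+ 6 * beta * #|` B ** C|%:R =
          alpha * (beta * (alpha ^+ 5 * #|` B ** C|%:R)) by ring.
by rewrite ler_wpM2r // !mulr_ge0 ?exprn_ge0 // ltW.
Qed.

Lemma card_powset_le (alpha beta : R) B n :
    0 < alpha -> 0 < beta -> #|` B ** B|%:R <= alpha * #|` B|%:R ->
    (forall b, b \in B -> #|` sandwich B b|%:R <= beta * #|` B|%:R) ->
  #|` powset B n.+2|%:R <= alpha ^+ (6 * n + 1) * beta ^+ n * #|` B|%:R.
Proof.
move=> alpha0 beta0 BB BbB; elim: n => [|n IHn].
  by rewrite /powset /= prodset1 muln0 expr1 expr0 mulr1.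
apply: le_trans (card_prodset_step (powset B n.+1) alpha0 beta0 BB BbB) _.
have -> : alpha ^+ (6 * n.+1 + 1) * beta ^+ n.+1 * #|` B|%:R =
    alpha ^+ 6 * beta * (alpha ^+ (6 * n + 1) * beta ^+ n * #|` B|%:R).
  by rewrite mulnS -addnA exprD [beta ^+ _]exprS; ring.
by rewrite ler_pM2l // mulr_gt0 ?exprn_gt0.
Qed.

End SmallDoubling.

Theorem theorem1p6 (R : realType) (G : groupType) (B : {fset G})
    (alpha beta : R) (halpha : 0 < alpha) (hbeta : 0 < beta)
    (hBB : #|` prodset B B|%:R <= alpha * #|` B|%:R)
    (hBbB : forall b : G, b \in B -> #|` sandwich B b|%:R <= beta * #|` B|%:R)
    (h : nat) (hh : (2 < h)%N) :
  #|` powset B h|%:R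
    <= alpha ^+ (8 * h - 17)%N * beta ^+ (h - 2)%N * #|` B|%:R.
Proof.
have [B0|B0] := eqVneq B fset0.
  by case: h hh => // h _; rewrite B0 /powset /= prod0set cardfs0 mulr0.
have alpha1 := doubling_ge1 B0 hBB.
case: h hh => [|[|n]] // n0; have -> : (n.+2 - 2 = n)%N by lia.
apply: le_trans (card_powset_le _ halpha hbeta hBB hBbB) _.
rewrite ler_wpM2r // ler_wpM2r ?exprn_ge0 ?(ltW hbeta) //.
(* The exponents compare as [6 n + 1 <= 8 n - 1], which needs [n >= 1], that is [h > 2]. *)
by apply: ler_weXn2l => //; lia.
Qed.
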